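(* Let $\bar t\in(0,\tfrac12)$, $\varepsilon\in(0,\bar t)$, $\delta\in(0,1)$, $n\ge\tfrac12\varepsilon^{-2}\log\tfrac1\delta$, and let $R:[0,\bar t]\to\mathbb{R}_{\ge0}$ be any strictly increasing function. Then there exist a distribution $F\in\mathcal{H}_{\bar t,R}$ and a joint distribution on $(D,Y,Z)$ with marginals $D\sim\mathrm{Ber}(\varepsilon)$ and $Y\sim F$, such that $F$ has a unique median $m_1(F)$ and $$\mathbb{P}\left(\left|\hat m_1(X_1,\dots,X_n)-m_1(F)\right|\ge R\left(\varepsilon-\sqrt{\frac{\log(1/\delta)}{2n}}\right)\right)\ge 1-\delta,$$ where the triples $(D_i,Y_i,Z_i)$, $i\in[n]$, are drawn independently from this joint distribution and $X_i:=(1-D_i)Y_i+D_iZ_i$.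
   Context: Distributions are on $\mathbb{R}$ and identified with their cdfs; $[n]=\{1,\dots,n\}$. For a cdf $F$, the left and right quantiles are $Q_{L,F}(p)=\inf\{x\in\mathbb{R}:F(x)\ge p\}$ and $Q_{R,F}(p)=\inf\{x\in\mathbb{R}:F(x)>p\}$. The set of medians of $F$ is $m_1(F)=[Q_{L,F}(\tfrac12),Q_{R,F}(\tfrac12)]$; when $F$ has a unique median, $m_1(F)$ denotes that point. The empirical median $\hat m_1(x_1,\dots,x_n)$ is the middle value if $n$ is odd and the average of the two middle values if $n$ is even. For $\bar t\in(0,\tfrac12)$ and a non-decreasing function $R:[0,\bar t]\to\mathbb{R}_{\ge0}$, $\mathcal{H}_{\bar t,R}$ is the family of all distributions $F$ satisfying $$R(t)\ge\max\left\{Q_{R,F}\left(\tfrac12+t\right)-m,\; m-Q_{L,F}\left(\tfrac12-t\right)\right\}$$ for every $t\in[0,\bar t]$ and every median $m\in m_1(F)$. *)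

(* Defs.v *)
From HB Require Import structures.
From mathcomp Require Import all_boot all_order all_algebra.
From mathcomp Require Import all_classical all_reals all_analysis.

Set Implicit Arguments.
Unset Strict Implicit.
Unset Printing Implicit Defensive.

Import Order.TTheory GRing.Theory Num.Theory.
Import numFieldNormedType.Exports.

Local Open Scope classical_set_scope.
Local Open Scope ring_scope.

Section distributions_on_the_line.
Context {K : realType}.
Implicit Type F : probability (measurableTypeR K) K.

(* The identity as a random variable: its law under F is F itself. *)
Definition id_line : measurableTypeR K -> K := idfun.

HB.instance Definition _ :=
  @isMeasurableFun.Build _ _ _ _ id_line (@measurable_id _ _ setT).

Definition cdf_of F (x : K) : K := fine (cdf (id_line : {RV F >-> K}) x).

(* For 0 < p < 1 both sets are nonempty and bounded below, so [inf] is the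
   actual infimum; outside that range it may be the junk value 0. *)
Definition lquantile F (p : K) : K := inf [set x | p <= cdf_of F x].
Definition rquantile F (p : K) : K := inf [set x | p < cdf_of F x].

Definition medians F : set K :=
  [set m | lquantile F 2^-1 <= m <= rquantile F 2^-1].

(* Only the values of [R] on [0, tbar] matter. *)
Definition Hfamily (tbar : K) (R : K -> K) F : Prop :=
  forall t m, 0 <= t <= tbar -> medians F m ->
    Num.max (rquantile F (2^-1 + t) - m) (m - lquantile F (2^-1 - t)) <= R t.

Definition empirical_median (s : seq K) : K :=
  let s' := sort <=%R s in
  let k := (size s)./2 in
  if odd (size s) then s'`_k else (s'`_k.-1 + s'`_k) / 2.

(* The observation (1 - D) Y + D Z from a triple (D, Y, Z), where D = 1 is
   encoded as [true]. *)
Definition observed (w : bool * K * K) : K :=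
  (1 - w.1.1%:R) * w.1.2 + w.1.1%:R * w.2.

End distributions_on_the_line.

Section random_samples.
Context {K : realType} {d d' : measure_display}.
Context {T : measurableType d} {T' : measurableType d'}.

(* Laws are compared on measurable sets only: outside the sigma-algebra the
   values of a measure carry no meaning. *)
Definition has_law (P : probability T K) (X : T -> T')
    (mu : probability T' K) : Prop :=
  forall A, measurable A -> pushforward P X A = mu A.

Definition mutually_independent (P : probability T K) (n : nat)
    (W : 'I_n -> {RV P >-> T'}) : Prop :=
  forall (J : {set 'I_n}) (A : 'I_n -> set T'),
    (forall i, measurable (A i)) ->
    P (\bigcap_(i in [set` J]) (W i @^-1` A i)) =
      (\prod_(i in J) P (W i @^-1` A i))%E.

Definition iid_sample (P : probability T K) (n : nat)
    (W : 'I_n -> {RV P >-> T'}) (mu : probability T' K) : Prop :=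
  mutually_independent W /\ forall i, has_law P (W i) mu.

End random_samples.

(* Main.v *)
(* Put c = sqrt (ln (1/delta) / 2n) and r = R (eps - c).  The law F has two
   atoms, 0 with mass a > 1/2 + eps - c and r with mass 1 - a, so its median is
   0 and its right quantiles above level a are r.  The adversary corrupts a part
   of mass eps of the event {Y = 0} and sends it to r; then X = r with
   probability 1/2 + b, where b < c.  Summing over the set of indices i with
   X_i = r, at most half of the sample equals r with probability at most
   2^n ((1/2 + b) (1/2 - b))^(n/2) = (1 - 4 b^2)^(n/2).  Since
   1 - 4 c^2 < exp (- 4 c^2), some b < c makes this equal to
   exp (- 2 n c^2) = delta.  The strict inequality b < c is what makes the
   median of F unique when eps = c. *)

Require Import Defs.
From HB Require Import structures.
From mathcomp Require Import all_boot all_order all_algebra.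
From mathcomp Require Import all_classical all_reals all_analysis.
From mathcomp Require Import measurable_realfun.
From mathcomp Require Import zify ring lra.

Set Implicit Arguments.
Unset Strict Implicit.
Unset Printing Implicit Defensive.

Import Order.TTheory GRing.Theory Num.Theory.
Import numFieldNormedType.Exports.

Local Open Scope classical_set_scope.
Local Open Scope ring_scope.

(** * Finitely supported laws *)

Lemma finite_mixture (K : realType) d (T : measurableType d) n
    (a : nat -> K) (x : nat -> T) :
    (forall k, 0 <= a k) -> \sum_(k < n) a k = 1 ->
  exists mu : probability T K,
    forall A, mu A = (\sum_(k < n) a k * \1_A (x k))%:E.
Proof.
move=> a0 a1.
pose m : {measure set T -> \bar K} := msum (fun k => mscale (NngNum (a0 k)) (dirac (x k))) n.
have mE A : m A = (\sum_(k < n) a k * \1_A (x k))%:E.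
  rewrite /m /msum -sumEFin; apply: eq_bigr => k _.
  by rewrite /= /mscale /= diracE indicE EFinM.
have mT : m setT = 1%E.
  rewrite mE -a1; congr EFin; apply: eq_bigr => k _.
  by rewrite indicT mulr1.
pose B := Measure_isProbability.Build _ _ _ m mT.
pose mu : probability T K := HB.pack (Measure.sort m) B.
by exists mu => A; rewrite -mE.
Qed.

(** * Order statistics by counting, and the empirical median *)

Lemma le_nth_sort (K : realType) (s : seq K) (t : K) k : (k < size s)%N ->
  (t <= (sort <=%R s)`_k) = (size s - k <= count (>= t) s)%N.
Proof.
rewrite -(count_sort <=%R) -(size_sort <=%R s).
have : sorted <=%R (sort <=%R s) by apply: sort_sorted; exact: le_total.
move: (sort _ _) => {}s s_sorted ks.
apply/idP/idP => [tk|].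
  rewrite -(cat_take_drop k s) count_cat.
  have -> : count (>= t) (drop k s) = size (drop k s).
    apply/eqP; rewrite -all_count; apply/(all_nthP 0) => i.
    rewrite size_drop => ik; rewrite nth_drop /=; apply: (le_trans tk).
    by apply: (sorted_leq_nth le_trans lexx); rewrite ?inE ?leq_addr -?ltn_subRL.
  by rewrite cat_take_drop size_drop leq_addl.
apply: contraTT; rewrite -ltNge -ltnNge => tk.
(* If entry [k] is below [t], so are all the first [k.+1] entries, which leaves at most
   [size s - k - 1] entries that reach [t]. *)
rewrite -(cat_take_drop k.+1 s) count_cat.
have -> : count (>= t) (take k.+1 s) = 0.
  apply/eqP; rewrite -leqn0 leqNgt -has_count; apply/(has_nthP 0) => -[i].
  rewrite size_takel// => ik; rewrite nth_take//= leNgt => /negP; apply.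
  apply: le_lt_trans tk.
  by apply: (sorted_leq_nth le_trans lexx) => //; rewrite inE (leq_trans ik).
rewrite cat_take_drop (leq_ltn_trans (count_size _ _))//.
by rewrite size_drop; lia.
Qed.

Lemma le_empirical_median (K : realType) (s : seq K) (t : K) :
  (size s < 2 * count (>= t) s)%N -> t <= empirical_median s.
Proof.
move=> st; have c_le : (count (>= t) s <= size s)%N by exact: count_size.
have sE := odd_double_half (size s).
rewrite /empirical_median; move: sE st; case: ifP => _ sE st.
  by rewrite le_nth_sort; lia.
(* For even size, a strict majority has at least [(size s)./2.+1] entries, exactly what the lower
   middle value needs. *)
have : t <= (sort <=%R s)`_(size s)./2.-1 by rewrite le_nth_sort; lia.
have : t <= (sort <=%R s)`_(size s)./2 by rewrite le_nth_sort; lia.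
by lra.
Qed.

(** Closed upper half-lines generate the Borel sets, and by [le_nth_sort] their preimages are
    superlevel sets of a finite sum of indicators. *)
Lemma measurable_nth_sort (K : realType) d (T : measurableType d) n
    (X : 'I_n -> T -> K) k : (forall i, measurable_fun setT (X i)) ->
  measurable_fun setT (fun x => (sort <=%R [seq X i x | i <- enum 'I_n])`_k).
Proof.
move=> mX; have [nk|kn] := leqP n k.
  rewrite (_ : (fun _ => _) = cst 0); first exact: measurable_cst.
  by apply/funext => x; rewrite nth_default// size_sort size_map size_enum_ord.
apply: (measurability (@RGenCInfty.G K)) => [|/= _ [_] [t] -> <-].
  exact: RGenCInfty.measurableE.
pose N x : K := \sum_(i < n) \1_(X i @^-1` `[t, +oo[) x.
have mN : measurable_fun setT N.
  apply: measurable_sum => i; apply: measurable_indic.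
  by rewrite -[_ @^-1` _]setTI; apply: mX.
rewrite (_ : _ `&` _ = setT `&` N @^-1` `[(n - k)%N%:R, +oo[); first exact: mN.
congr (_ `&` _); apply/funext => x; apply/propext => /=.
have sX : size [seq X i x | i <- enum 'I_n] = n.
  by rewrite size_map size_enum_ord.
rewrite !in_itv/= !andbT le_nth_sort sX//.
rewrite /N (_ : \sum_(i < n) _ =
  (count (>= t) [seq X i x | i <- enum 'I_n])%:R) ?ler_nat//.
rewrite count_map -sum1_count natr_sum [RHS]big_mkcond big_enum/=.
apply: eq_bigr => i _; rewrite indicE; case: ifPn => [tX|tX].
  by rewrite mem_set//= in_itv/= andbT.
by rewrite memNset//= in_itv/= andbT; exact/negP.
Qed.

Lemma measurable_empirical_median (K : realType) d (T : measurableType d) n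
    (X : 'I_n -> T -> K) : (forall i, measurable_fun setT (X i)) ->
  measurable_fun setT (fun x => empirical_median [seq X i x | i <- enum 'I_n]).
Proof.
move=> mX; pose Y k x := (sort <=%R [seq X i x | i <- enum 'I_n])`_k.
have mY k : measurable_fun setT (Y k) by exact: measurable_nth_sort.
rewrite (_ : (fun _ => _) =
    if odd n then Y n./2 else fun x => (Y n./2.-1 x + Y n./2 x) / 2).
  by case: ifP => // _; apply: measurable_funM => //; exact: measurable_funD.
apply/funext => x.
by rewrite /empirical_median size_map size_enum_ord; case: ifP.
Qed.

(** * Probability that at most half of the sample falls in a set *)

Lemma minority_probability (K : realType) d d' (T : measurableType d)
    (T' : measurableType d') (P : probability T K) (mu : probability T' K) n
    (W : 'I_n -> {RV P >-> T'}) (B : set T') (b g : K) :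
    iid_sample W mu -> measurable B -> mu B = b%:E ->
    0 <= 1 - b <= g -> b * (1 - b) = g ^+ 2 ->
  let N := [set x | (2 * #|[set i | W i x \in B]%SET| <= n)%N] in
  measurable N /\ (P N <= ((2 * g) ^+ n)%:E)%E.
Proof.
move=> [indW lawW] mB muB /andP[q0 qg] bqg N.
have g0 : 0 <= g by exact: le_trans qg.
(* [E J] below is the event that [J] is exactly the set of indices [i] with [W i] in [B]. The events
   [E J] with [J] of size at most [n / 2] cover [N], and a union bound follows. *)
pose C (J : {set 'I_n}) i := if i \in J then B else ~` B.
have mC J i : measurable (C J i) by rewrite /C; case: ifP => // _; exact: measurableC.
pose E (J : {set 'I_n}) : set T :=
  \bigcap_(i in [set` [set: 'I_n]%SET]) (W i @^-1` C J i).
have mWC i A : measurable A -> measurable (W i @^-1` A).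
  by move=> mA; rewrite -[_ @^-1` _]setTI; exact: (measurable_funP (W i)).
have mE J : measurable (E J).
  by apply: fin_bigcap_measurable => // i _; exact: mWC.
have PW i A : measurable A -> P (W i @^-1` A) = mu A by move=> mA; rewrite -(lawW i).
have muBC : mu (~` B) = (1 - b)%:E by rewrite probability_setC// muB -EFinB.
have PE J : P (E J) = (b ^+ #|J| * (1 - b) ^+ (n - #|J|))%:E.
  rewrite /E indW//.
  have -> : (\prod_(i in [set: 'I_n]%SET) P (W i @^-1` C J i))%E =
      (\prod_(i < n) (if i \in J then b else 1 - b))%:E.
    rewrite -prodEFin; apply: eq_big => [i|i _]; first by rewrite finset.in_setT.
    by rewrite PW// /C; case: ifP.
  congr EFin; rewrite (bigID (mem J))/=; congr (_ * _).
    by rewrite (eq_bigr (fun=> b)) ?prodr_const// => i ->.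
  rewrite (eq_bigr (fun=> 1 - b)) ?prodr_const => [|i /negbTE ->//].
  congr (_ ^+ _); have := cardC (mem J); rewrite card_ord => cJ.
  by rewrite -[X in (X - _)%N]cJ addKn.
pose A (J : {set 'I_n}) := if (2 * #|J| <= n)%N then E J else set0.
have mA J : measurable (A J) by rewrite /A; case: ifP.
have PA J : (P (A J) <= (g ^+ n)%:E)%E.
  rewrite /A; case: ifP => Jn; last by rewrite measure0 lee_fin exprn_ge0.
  rewrite PE lee_fin.
  (* Each factor [b] is paired with a factor [1 - b], giving [g ^+ 2]; each of the [n - 2 * #|J|]
     unpaired factors [1 - b] is at most [g]. *)
  have -> : (n - #|J| = #|J| + (n - 2 * #|J|))%N by lia.
  rewrite exprD mulrA -exprMn bqg -exprM.
  rewrite [leRHS](_ : _ = g ^+ (2 * #|J|) * g ^+ (n - 2 * #|J|)); last first.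
    by rewrite -exprD subnKC.
  by rewrite ler_wpM2l ?exprn_ge0// lerXn2r ?nnegrE.
have NA : N = \bigcup_(J in [set` enum {set 'I_n}]) A J.
  apply/seteqP; split => x /=.
    move=> Nx; exists [set i | W i x \in B]%SET; first by rewrite /= mem_enum.
    rewrite /A Nx => i _ /=; rewrite /C inE; case: ifP => [/set_mem//|].
    by move=> /negbT; rewrite notin_setE.
  move=> [J _]; rewrite /A; case: ifP => // Jn Ex.
  rewrite /N/= (_ : [set i | _]%SET = J)//; apply/setP => i; rewrite inE.
  have := Ex i; rewrite /= finset.in_setT /C => /(_ erefl); case: ifP => _ Bx.
    exact: mem_set.
  exact: memNset.
have mN : measurable N by rewrite NA; exact: fin_bigcup_measurable.
split=> //.
apply: (@le_trans _ _ (\sum_(J \in [set` enum {set 'I_n}]) P (A J))%E).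
  by apply: content_sub_fsum => //; rewrite NA.
rewrite -fsbig_seq ?enum_uniq//.
apply: (@le_trans _ _ (\sum_(J <- enum {set 'I_n}) (g ^+ n)%:E)%E).
  by apply: lee_sum => J _.
(* There are [2 ^ n] index sets, each contributing at most [g ^+ n]. *)
rewrite sumEFin lee_fin big_enum/= sumr_const -cardsT -powersetT card_powerset.
by rewrite cardsT card_ord -[_ *+ (2 ^ n)]mulr_natl natrX -exprMn.
Qed.

(** * The two-point law and the choice of the bias *)

Lemma two_point_quantiles (K : realType) (F : probability (measurableTypeR K) K)
    (a r : K) : 0 < a < 1 -> 0 <= r ->
    (forall A, F A = (a * \1_A (0 : K) + (1 - a) * \1_A r)%:E) ->
  [/\ forall p, 0 < p <= a -> lquantile F p = 0,
      forall p, 0 <= p < a -> rquantile F p = 0 &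
      forall p, a <= p < 1 -> rquantile F p = r].
Proof.
move=> /andP[a0 a1] r0 FE.
have cdfE x : cdf_of F x = a * (0 <= x)%R%:R + (1 - a) * (r <= x)%R%:R.
  rewrite /cdf_of /cdf /distribution /pushforward FE/= !indicE.
  by congr (_ * _%:R + _ * _%:R); rewrite mem_setE/= in_itv.
have cdf_neg x : x < 0 -> cdf_of F x = 0.
  by move=> x0; rewrite cdfE !leNgt x0 (lt_le_trans x0 r0)/= !mulr0 addr0.
have cdf_ge0 x : 0 <= x -> a <= cdf_of F x.
  by move=> x0; rewrite cdfE x0 mulr1 lerDl mulr_ge0// subr_ge0 ltW.
have cdf_lt x : x < r -> cdf_of F x <= a.
  move=> xr; rewrite cdfE (leNgt r) xr/= mulr0 addr0.
  by case: (0 <= x); rewrite ?mulr1 ?mulr0 // ltW.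
have cdf_ge x : r <= x -> cdf_of F x = 1.
  by move=> rx; rewrite cdfE rx (le_trans r0 rx) !mulr1 addrC subrK.
(* Every quantile set here is a closed half-line, so its infimum is its endpoint. *)
have infE (y : K) (S : set K) : (forall x, S x <-> y <= x) -> inf S = y.
  move=> Sy; rewrite (_ : S = [set` `[y, +oo[]) ?inf_itv//.
  by apply/funext => x; apply/propext; rewrite /= in_itv/= andbT.
split=> p /andP[p1 p2]; apply: infE => x /=.
- split=> [|/cdf_ge0]; last exact: le_trans.
  by apply: contraTT; rewrite -!ltNge => /cdf_neg ->.
- split=> [|/cdf_ge0]; last exact: lt_le_trans.
  by apply: contraTT; rewrite -leNgt -ltNge => /cdf_neg ->.
- split=> [|/cdf_ge ->//].
  by apply: contraTT; rewrite -leNgt -ltNge => /cdf_lt /le_trans; apply.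
Qed.

(** The last equation forces [b = sqrt (1/4 - g^2)], and [1 - 4 c^2 < exp (- 4 c^2) = 4 g^2] then
    gives [b < c]. The bound [2^-1 - b <= g] holds because the smaller of two factors is at most
    their geometric mean. *)
Lemma strict_chernoff_bias (K : realType) (c : K) : 0 < c ->
  let g := expR (- 2 * c ^+ 2) / 2 in
  exists b, [/\ 0 <= b < c, b < 2^-1, 2^-1 - b <= g &
    (2^-1 + b) * (2^-1 - b) = g ^+ 2].
Proof.
move=> c0 g.
have g0 : 0 < g by rewrite divr_gt0 ?expR_gt0.
have g1 : g <= 2^-1.
  rewrite ler_pdivrMr// mulVf ?pnatr_eq0// -expR0 ler_expR mulNr oppr_le0.
  by rewrite mulr_ge0 ?sqr_ge0.
have g4 : 4 * g ^+ 2 = expR (- 4 * c ^+ 2).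
  rewrite (_ : - 4 * c ^+ 2 = 2%:R * (- 2 * c ^+ 2)); last by ring.
  by rewrite expRM_natl /g; field.
have g_gt : 1 - 4 * c ^+ 2 < 4 * g ^+ 2.
  rewrite g4 -mulNr expR_gt1Dx// mulf_neq0 ?oppr_eq0 ?pnatr_eq0//.
  by rewrite expf_neq0 ?gt_eqF.
have d0 : 0 <= 4^-1 - g ^+ 2 by nra.
pose b := Num.sqrt (4^-1 - g ^+ 2).
have b0 : 0 <= b by exact: sqrtr_ge0.
have b2 : b ^+ 2 = 4^-1 - g ^+ 2 by rewrite sqr_sqrtr.
have bc : b < c by rewrite -(ltr_pXn2r (n := 2)) ?nnegrE// ?(ltW c0)// b2; lra.
have b1 : b < 2^-1 by nra.
exists b; split=> //; first by rewrite b0.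
- by nra.
- by rewrite (_ : _ * _ = 4^-1 - b ^+ 2); [rewrite b2; ring|field].
Qed.

(** * The contaminated sample and the lower bound *)

Lemma measurable_observed (K : realType) : measurable_fun setT
  (observed : (bool * measurableTypeR K * measurableTypeR K)%type -> K).
Proof.
have mb (f : bool -> K) :
    measurable_fun setT
      (fun w : bool * measurableTypeR K * measurableTypeR K => f w.1.1).
  apply: (measurableT_comp (f := f)); first by [].
  exact: (measurableT_comp measurable_fst).
apply: measurable_funD; apply: measurable_funM.
- exact: (mb (fun D => 1 - D%:R)).
- exact: (measurableT_comp measurable_snd).
- exact: (mb (fun D => D%:R)).
- exact: measurable_snd.
Qed.

Theorem lemma8 (K : realType) (tbar eps delta : K) (n : nat) (R : K -> K)
    (tbar_bnd : 0 < tbar < 2^-1)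
    (eps_bnd : 0 < eps < tbar)
    (delta_bnd : 0 < delta < 1)
    (n_ge : 2^-1 * eps ^- 2 * ln (1 / delta) <= n%:R)
    (R_ge0 : forall t : K, 0 <= t <= tbar -> 0 <= R t)
    (R_incr : forall s t : K, 0 <= s -> s < t -> t <= tbar -> R s < R t) :
  exists (F : probability (measurableTypeR K) K)
         (mu : probability (bool * measurableTypeR K * measurableTypeR K)%type K)
         (m : K),
    [/\ Hfamily tbar R F,
        has_law mu (fun w => w.1.1) (bernoulli_prob eps),
        has_law mu (fun w => w.1.2) F,
        medians F = [set m] &
        forall (d : measure_display) (T : measurableType d)
               (P : probability T K)
               (W : 'I_n -> {RV P >->
                  (bool * measurableTypeR K * measurableTypeR K)%type}),
          iid_sample W mu ->
          ((1 - delta)%:E <=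
            P [set x : T |
                (R (eps - Num.sqrt (ln (1 / delta) / (2 * n%:R))) <=
                 `| empirical_median [seq observed (W i x) | i <- enum 'I_n]
                    - m |)%R])%E].
Proof.
have [/andP[tb0 tb1] /andP[e0 et] /andP[d0 d1]] := And3 tbar_bnd eps_bnd delta_bnd.
set L := ln (1 / delta).
have L0 : 0 < L by rewrite ln_gt0// ltr_pdivlMr// mul1r.
have n0 : 0 < n%:R :> K.
  by apply: lt_le_trans n_ge; rewrite !mulr_gt0// invr_gt0 exprn_gt0.
set c := Num.sqrt _.
have c0 : 0 < c by rewrite sqrtr_gt0 divr_gt0// mulr_gt0.
have c2 : c ^+ 2 = L / (2 * n%:R) by rewrite sqr_sqrtr// ltW// divr_gt0// mulr_gt0.
(* This is the sample size condition, with square roots taken; it keeps [eps - c] in the domain of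
   [R]. *)
have ce : c <= eps.
  rewrite -(ler_pXn2r (n := 2)) ?nnegrE ?(ltW c0) ?(ltW e0)// c2 ler_pdivrMr ?mulr_gt0//.
  have : 2^-1 * L / eps ^+ 2 <= n%:R by rewrite mulrAC.
  by rewrite ler_pdivrMr ?exprn_gt0//; lra.
have [b [/andP[b0 bc] b1 bg bb]] := strict_chernoff_bias c0.
set g := expR _ / 2 in bg bb.
have gn : (2 * g) ^+ n = delta.
  rewrite mulrC mulfVK ?pnatr_eq0// -expRM_natl.
  rewrite (_ : n%:R * _ = - L).
    by rewrite expRN lnK ?posrE ?divr_gt0// div1r invrK.
  by rewrite c2; field; rewrite gt_eqF.
set r := R (eps - c).
have r0 : 0 <= r by apply: R_ge0; lra.
(* Chosen so that the corrupted mass [eps] and the clean mass [1 - a] at [r] add up to [2^-1 + b].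
   Since [b < c <= eps], also [a > 2^-1]. *)
pose a := 2^-1 + eps - b.
have a01 : 0 < a < 1 by rewrite /a; lra.
have [F FE] : exists F : probability (measurableTypeR K) K,
    forall A, F A = (a * \1_A (0 : K) + (1 - a) * \1_A r)%:E.
  have [||F FE] := @finite_mixture K _ (measurableTypeR K) 2
    (fun k => nth 0 [:: a; 1 - a] k) (fun k => nth 0 [:: 0; r] k).
  - by case=> [|[|[|k]]] /=; lra.
  - by rewrite !big_ord_recl big_ord0/=; ring.
  - by exists F => A; rewrite FE !big_ord_recl big_ord0/= addr0.
(* [Z] is always [r], and [D] is true only where [Y] is 0; the mass [2^-1 - b = a - eps] is the
   uncorrupted part of that event. *)
have [mu muE] : exists mu :
      probability (bool * measurableTypeR K * measurableTypeR K)%type K,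
    forall A, mu A = (eps * \1_A (true, 0 : K, r) +
      (2^-1 - b) * \1_A (false, 0 : K, r) + (1 - a) * \1_A (false, r, r))%:E.
  pose w0 : bool * measurableTypeR K * measurableTypeR K := (true, 0, r).
  have [||mu muE] := @finite_mixture K _ _ 3
    (fun k => nth 0 [:: eps; 2^-1 - b; 1 - a] k)
    (fun k => nth w0 [:: w0; (false, 0, r); (false, r, r)] k).
  - by case=> [|[|[|[|k]]]] /=; lra.
  - by rewrite !big_ord_recl big_ord0/= /a; field.
  - by exists mu => A; rewrite muE !big_ord_recl big_ord0/= addr0 addrA.
have [lq0 rq0 rqr] := two_point_quantiles a01 r0 FE.
have medF : medians F = [set 0].
  rewrite /medians lq0 ?rq0; [|rewrite /a; lra|rewrite /a; lra].
  by apply/funext => x; apply/propext; rewrite /= -eq_le eq_sym; split => [/eqP|->].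
exists F, mu, 0; split=> //.
- move=> t m /andP[t0 tt]; rewrite medF => ->.
  rewrite lq0; last by rewrite /a; lra.
  rewrite !subr0 ge_max R_ge0 ?t0// andbT.
  (* The right quantile jumps to [r] only once [t >= eps - b > eps - c], and then
     [r = R (eps - c) < R t]. *)
  have [ta|at_] := ltP (2^-1 + t) a; first by rewrite rq0 ?R_ge0 ?t0//; lra.
  rewrite rqr; last by lra.
  by apply/ltW/R_incr => //; move: at_; rewrite /a; lra.
- move=> A mA; rewrite /pushforward muE /= bernoulli_probE; last by lra.
  rewrite !diracE !indicE -!EFinM -EFinD.
  rewrite /unstable.onem /a -[_ \in _ @^-1` _]/(true \in A).
  rewrite -![(false, _, _) \in _]/(false \in A).
  by congr EFin; field.
- move=> A mA; rewrite /pushforward muE FE !indicE.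
  rewrite -![(_, 0, _) \in _]/(0 \in A) -[(_, r, _) \in _]/(r \in A).
  by congr EFin; rewrite /a; ring.
move=> d T P W iidW.
(* If [r = 0] the event is certain. Otherwise the observation 0 lies below [r], so the atom
   [(false, 0, r)] stays outside [B]. *)
have [r_0|r_gt0] : r = 0 \/ 0 < r.
  by move: r0; rewrite le_eqVlt => /orP[/eqP|]; auto.
  rewrite (_ : [set x | _] = setT) ?probability_setT ?lee_fin; first by lra.
  by apply/seteqP; split => x //= _; rewrite r_0.
pose B := [set w : bool * measurableTypeR K * measurableTypeR K | r <= observed w].
have mB : measurable B.
  rewrite (_ : B = setT `&` observed @^-1` `[r, +oo[); last first.
    apply/funext => w; apply/propext.
    by rewrite /B/= in_itv/= andbT; split => [|[]].
  exact: measurable_observed.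
have inB w : (w \in B) = (r <= observed w) by apply/idP/idP => [/set_mem|/mem_set].
have muB : mu B = (2^-1 + b)%:E.
  rewrite muE !indicE !inB /observed/= !(subr0, subrr, mul0r, mul1r, addr0, add0r).
  by rewrite lexx leNgt r_gt0/= /a; congr EFin; field.
have qE : 1 - (2^-1 + b) = 2^-1 - b by field.
have [||mN] := minority_probability iidW mB muB (g := g).
- by rewrite qE bg andbT; lra.
- by rewrite qE.
rewrite gn => PN.
set N := [set x | _] in mN PN; set E := [set x | _].
have mX i : measurable_fun setT (fun x => observed (W i x)).
  exact: (measurableT_comp (@measurable_observed K)).
have mE : measurable E.
  rewrite (_ : E = setT `&` (fun x => `|empirical_median
    [seq observed (W i x) | i <- enum 'I_n]|) @^-1` `[r, +oo[); last first.
    apply/funext => x; apply/propext.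
    by rewrite /E/= in_itv/= subr0 andbT; split => [|[]].
  have := measurable_empirical_median mX.
  by move=> /(measurableT_comp (@normr_measurable K setT)); exact.
apply: (@le_trans _ _ (P (~` N))).
  by rewrite probability_setC// EFinB leeB.
apply: le_measure; rewrite ?inE//; first exact: measurableC.
(* Outside [N] a strict majority of the observations is at least [r], hence so is the empirical
   median. *)
move=> x /negP; rewrite -ltnNge => xn; rewrite /E/= subr0.
apply: le_trans (ler_norm _); apply: le_empirical_median.
rewrite size_map size_enum_ord (leq_trans xn)// leq_mul2l/=.
rewrite count_map -sum1_count big_enum_cond/= sum1_card subset_leq_card//.
by apply/fintype.subsetP => i; rewrite inE inB.
Qed.
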